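(* (1) $1\mathrm{N}\subsetneqq \mathrm{co}\text{-}1\mathrm{C}_{=}$ and $\mathrm{co}\text{-}1\mathrm{N}\subsetneqq 1\mathrm{C}_{=}$. (2) $1\mathrm{N}\nsubseteq 1\mathrm{C}_{=}$.
   Context: A one-way nondeterministic finite automaton (1nfa) is $M=(Q,\Sigma,\{\rhd,\lhd\},\delta,q_0,Q_{acc},Q_{rej})$: finite state set $Q$, input alphabet $\Sigma$, endmarkers $\rhd,\lhd\notin\Sigma$, disjoint sets $Q_{acc},Q_{rej}\subseteq Q$ of accepting and rejecting states (halting states $Q_{halt}=Q_{acc}\cup Q_{rej}$), and transition function $\delta:(Q-Q_{halt})\times(\Sigma\cup\{\rhd,\lhd\})\to\mathcal P(Q)$. On input $x$ it reads $\rhd x\lhd$ left to right, moving its head one cell right at every step (no $\lambda$-moves), and halts when entering a halting state. A computation path is accepting (resp. rejecting) if it enters a state of $Q_{acc}$ (resp. $Q_{rej}$); a path that reads off $\lhd$ without entering a halting state is neither. $\#M(x)$ and $\#\overline{M}(x)$ denote the numbers of accepting and of rejecting computation paths of $M$ on $x$. The state complexity of $M$ is $|Q|$; a family $\{M_n\}_{n\in\mathbb N}$ has polynomial size if the state complexity of $M_n$ is at most $p(n)$ for a fixed polynomial $p$. A family of promise problems over a fixed alphabet $\Sigma$ is $\mathcal L=\{(L_n^{(+)},L_n^{(-)})\}_{n\in\mathbb N}$ with $L_n^{(+)},L_n^{(-)}\subseteq\Sigma^*$ disjoint. Its complement is $\mathrm{co}\text{-}\mathcal L=\{(L_n^{(-)},L_n^{(+)})\}_n$,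 and for a class $\mathcal C$ of such families, $\mathrm{co}\text{-}\mathcal C=\{\mathrm{co}\text{-}\mathcal L:\mathcal L\in\mathcal C\}$. A family of partial functions is $\{(f_n,D_n)\}_n$ with $f_n$ defined on $D_n\subseteq\Sigma^*$. $1\#$ is the class of such families for which some polynomial-size family of 1nfa's $\{M_n\}$ satisfies $f_n(x)=\#M_n(x)$ for all $n$ and $x\in D_n$; $1\mathrm{Gap}$ is defined the same way with $f_n(x)=\#M_n(x)-\#\overline{M}_n(x)$. $\mathcal L\in 1\mathrm N$ iff there is $\{(f_n,D_n)\}\in1\#$ with $L_n^{(+)}\cup L_n^{(-)}\subseteq D_n$, $f_n(x)>0$ for $x\in L_n^{(+)}$ and $f_n(x)=0$ for $x\in L_n^{(-)}$, for all $n$. $\mathcal L\in 1\mathrm C_{=}$ iff there is $\{(f_n,D_n)\}\in1\mathrm{Gap}$ with $L_n^{(+)}\cup L_n^{(-)}\subseteq D_n$, $f_n(x)=0$ for $x\in L_n^{(+)}$ and $f_n(x)\neq0$ for $x\in L_n^{(-)}$, for all $n$. *)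

(* Defs.v *)
From mathcomp Require Import all_boot all_order all_algebra.
From mathcomp Require Import boolp classical_sets.

Set Implicit Arguments.
Unset Strict Implicit.
Unset Printing Implicit Defensive.

Local Open Scope ring_scope.
Local Open Scope classical_set_scope.

Inductive tape_symbol (Sigma : Type) : Type :=
  | LeftEnd
  | RightEnd
  | Letter of Sigma.
Arguments LeftEnd {Sigma}.
Arguments RightEnd {Sigma}.

Definition tape (Sigma : Type) (x : seq Sigma) : seq (tape_symbol Sigma) :=
  LeftEnd :: rcons (map (@Letter Sigma) x) RightEnd.

(* [nfa_delta] is total, but its values at halting states are never used:
   see [computation_path]. *)
Record nfa (Sigma : finType) := Nfa {
  nfa_state :> finType;
  nfa_delta : nfa_state -> tape_symbol Sigma -> {set nfa_state};
  nfa_init : nfa_state;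
  nfa_acc : {set nfa_state};
  nfa_rej : {set nfa_state};
  nfa_disj : [disjoint nfa_acc & nfa_rej]%bool
}.

Section Paths.
Variables (Sigma : finType) (M : nfa Sigma).

Definition nfa_halt : {set M} := (nfa_acc M :|: nfa_rej M)%SET.

(* [p] lists the states entered, one per tape cell read, by a complete
   computation path that is in state [q] with [w] still to be read. The path
   ends in a halting state or by reading off the whole of [w]. *)
Fixpoint computation_path (q : M) (w : seq (tape_symbol Sigma)) (p : seq M)
    : bool :=
  match p, w with
  | [::], _ => (q \in nfa_halt) || nilp w
  | q' :: p', a :: w' =>
      [&& q \notin nfa_halt, q' \in nfa_delta q a & computation_path q' w' p']
  | _ :: _, [::] => false
  end.

(* Number of computation paths on [x] that end in [F]; a path makes at most
   [size (tape x)] steps, so bounded sequences cover all of them. *)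
Definition num_paths (F : {set M}) (x : seq Sigma) : nat :=
  #|[set p : (size (tape x)).-bseq M
      | computation_path (nfa_init M) (tape x) p
        && (last (nfa_init M) p \in F)]%SET|.

Definition num_acc_paths : seq Sigma -> nat := num_paths (nfa_acc M).
Definition num_rej_paths : seq Sigma -> nat := num_paths (nfa_rej M).

End Paths.

Definition poly_size (Sigma : finType) (M : nat -> nfa Sigma) : Prop :=
  exists p : {poly nat}, forall n : nat, (#|M n| <= p.[n])%N.

(* The values of [pf_val f n] outside [pf_dom f n] are irrelevant. *)
Record pfun_family (Sigma : finType) (V : Type) := PfunFamily {
  pf_dom : nat -> set (seq Sigma);
  pf_val :> nat -> seq Sigma -> V
}.

Definition one_sharp (Sigma : finType) : set (pfun_family Sigma nat) :=
  [set f | exists M : nat -> nfa Sigma, poly_size M /\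
    forall n x, pf_dom f n x -> f n x = num_acc_paths (M n) x].

Definition one_gap (Sigma : finType) : set (pfun_family Sigma int) :=
  [set f | exists M : nat -> nfa Sigma, poly_size M /\
    forall n x, pf_dom f n x ->
      f n x = (num_acc_paths (M n) x)%:Z - (num_rej_paths (M n) x)%:Z].

(* The alphabet belongs to the family: it is common to all [n], but a class
   contains families over every alphabet. *)
Record promise_family := PromiseFamily {
  alphabet : finType;
  alphabet_gt0 : (0 < #|alphabet|)%N;
  yes : nat -> set (seq alphabet);
  no : nat -> set (seq alphabet);
  yes_no_disj : forall n, yes n `&` no n = set0
}.
Arguments yes : clear implicits.
Arguments no : clear implicits.

Lemma no_yes_disj (L : promise_family) (n : nat) : no L n `&` yes L n = set0.
Proof. by rewrite setIC; apply: yes_no_disj. Qed.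

Definition co_family (L : promise_family) : promise_family :=
  PromiseFamily (alphabet_gt0 L) (@no_yes_disj L).

(* [promise_family] quantifies over [finType], so it is too large for the
   universe of [set]; classes of families are plain predicates. *)
Definition family_class := promise_family -> Prop.

Definition class_sub (C D : family_class) : Prop := forall L, C L -> D L.

Definition class_proper (C D : family_class) : Prop :=
  class_sub C D /\ ~ class_sub D C.

Definition co (C : family_class) : family_class :=
  fun L => exists2 L', C L' & L = co_family L'.

Definition oneN : family_class := fun L =>
  exists f : pfun_family (alphabet L) nat, one_sharp f /\
    forall n, [/\ yes L n `|` no L n `<=` pf_dom f n,
                  forall x, yes L n x -> (0 < f n x)%N
                & forall x, no L n x -> f n x = 0%N].

Definition oneCeq : family_class := fun L =>
  exists f : pfun_family (alphabet L) int, one_gap f /\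
    forall n, [/\ yes L n `|` no L n `<=` pf_dom f n,
                  forall x, yes L n x -> f n x = 0
                & forall x, no L n x -> f n x <> 0].

(* Main.v *)
(** Turning rejecting states into dead ends makes the gap of a machine equal to
    its number of accepting paths, whence 1N is contained in co-1C_=.

    The inclusion is strict because a constant-size machine has gap
    #a(x) - #b(x), whereas no 1nfa accepts exactly the words with
    #a(x) <> #b(x): by pigeonhole two prefixes a^i and a^j with i <> j reach the
    same set of states, so a^i b^i would be accepted along with a^j b^i.

    Words uv with |u| = |v| = n and u <> v are accepted with O(n) states by
    guessing a position where u and v differ. A gap function vanishing exactly
    on these words gives a 2^n x 2^n diagonal matrix of full rank; splitting
    paths at the middle of the word factors this matrix through a space of
    dimension the number of states, which is therefore at least 2^n. *)

From mathcomp Require Import all_boot all_order all_algebra.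
From mathcomp Require Import boolp classical_sets.
From mathcomp Require Import zify.
Require Import Defs.

Set Implicit Arguments.
Unset Strict Implicit.
Unset Printing Implicit Defensive.

Import GRing.Theory Num.Theory.

(** * Counting computation paths by recursion on the unread tape *)

Section PathCounting.
Variables (Sigma : finType) (M : nfa Sigma).
Implicit Types (q s : M) (w : seq (tape_symbol Sigma)) (F : {set M}).

Fixpoint paths q w : seq (seq M) :=
  if q \in nfa_halt M then [:: [::]] else
  if w is a :: w' then
    [seq q' :: p | q' <- enum (nfa_delta q a), p <- paths q' w']
  else [:: [::]].

Lemma mem_paths q w p : (p \in paths q w) = computation_path q w p.
Proof.
elim: w q p => [|a w IH] q p /=.
  by case: p => [|q' p]; case: ifP; rewrite mem_seq1 ?orbT.
case: ifP => qH; first by case: p => [|q' p] //=; rewrite mem_seq1 ?qH.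
case: p => [|q' p] /=; rewrite ?qH /=.
  by apply/negbTE/negP => /allpairsPdep[x [y [_ _]]].
apply/allpairsPdep/idP => [[x [y [xd yw [-> ->]]]]|/andP[qd cp]].
  by rewrite -IH yw -mem_enum xd.
by exists q', p; rewrite mem_enum qd IH.
Qed.

Lemma uniq_paths q w : uniq (paths q w).
Proof.
elim: w q => [|a w IH] q /=; case: ifP => // _.
apply: allpairs_uniq_dep => [|q' _|]; [exact: enum_uniq|exact: IH|].
by move=> [x p] [y r] _ _ /= [-> ->].
Qed.

Lemma size_paths q w p : p \in paths q w -> size p <= size w.
Proof.
elim: w q p => [|a w IH] q p /=; case: ifP => _; try by rewrite mem_seq1 => /eqP->.
by case/allpairsPdep=> x [y [_ yw ->]]; apply: IH yw.
Qed.

Fixpoint count_paths F q w : nat :=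
  if q \in nfa_halt M then nat_of_bool (q \in F) else
  if w is a :: w' then \sum_(q' in nfa_delta q a) count_paths F q' w'
  else q \in F.

Lemma count_pathsE F q w :
  count_paths F q w = count (fun p => last q p \in F) (paths q w).
Proof.
elim: w q => [|a w IH] q /=; case: ifP => _ /=; rewrite ?addn0 //.
rewrite count_flatten sumnE !big_map big_enum /=.
by apply: eq_bigr => q' _; rewrite IH count_map.
Qed.

(** The length bound in [num_paths] loses nothing by [size_paths], so its set and the filtered list
    [paths] are duplicate-free with the same members. *)
Lemma num_pathsE F x : num_paths F x = count_paths F (nfa_init M) (tape x).
Proof.
rewrite count_pathsE -size_filter /num_paths cardE -(size_map val).
apply: perm_size; apply: uniq_perm.
- by rewrite (map_inj_uniq val_inj) enum_uniq.
- by rewrite filter_uniq ?uniq_paths.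
move=> p; rewrite mem_filter mem_paths andbC.
apply/mapP/idP => [[b]|cp]; first by rewrite mem_enum inE => ? ->.
have sp : size p <= size (tape x).
  by case/andP: cp => cp _; apply: (@size_paths (nfa_init M)); rewrite mem_paths.
by exists (Bseq sp); rewrite ?mem_enum ?inE.
Qed.

Lemma count_paths_halt F q w :
  q \in nfa_halt M -> count_paths F q w = (q \in F).
Proof. by case: w => [|a w] /= ->. Qed.

(* Halted paths stay where they halted, which makes [count_paths_cat] linear. *)
Fixpoint reach q w s : nat :=
  if q \in nfa_halt M then nat_of_bool (q == s) else
  if w is a :: w' then \sum_(q' in nfa_delta q a) reach q' w' s
  else q == s.

Lemma count_paths_cat F q u v :
  count_paths F q (u ++ v) = \sum_s reach q u s * count_paths F s v.
Proof.
have pick0 r : \sum_s (r == s) * count_paths F s v = count_paths F r v.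
  rewrite (bigD1 r) //= eqxx mul1n big1 ?addn0 // => s.
  by rewrite eq_sym => /negbTE->.
elim: u q => [|a u IH] q /=; case: (boolP (q \in nfa_halt M)) => qH; rewrite ?pick0 //.
  by rewrite count_paths_halt.
under eq_bigr do rewrite IH.
by rewrite exchange_big; apply: eq_bigr => s _; rewrite big_distrl.
Qed.

(** The prefix [u] matters only through the set of states it reaches, which is what the pigeonhole
    argument uses. *)
Lemma count_paths_gt0_cat F q u v :
  (0 < count_paths F q (u ++ v)) =
  [exists s in [set s | 0 < reach q u s], 0 < count_paths F s v].
Proof.
rewrite count_paths_cat lt0n sum_nat_eq0 negb_forall; apply: eq_existsb => s.
by rewrite inE -lt0n muln_gt0.
Qed.

End PathCounting.

Lemma tape_cat (Sigma : Type) (u v : seq Sigma) :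
  tape (u ++ v) =
  (LeftEnd :: map (@Letter Sigma) u) ++ rcons (map (@Letter Sigma) v) RightEnd.
Proof. by rewrite /tape map_cat rcons_cat. Qed.

Lemma co_familyK : involutive co_family.
Proof.
by case=> S S0 y n d; rewrite /co_family; congr PromiseFamily; apply: Prop_irrelevance.
Qed.

(** * 1N inside co-1C_= *)

Section DropRejection.
Variables (Sigma : finType) (M : nfa Sigma).

Lemma disjoint_acc_set0 : [disjoint nfa_acc M & (finset.set0 : {set M})].
Proof. by rewrite -setI_eq0 finset.setI0. Qed.

(* Paths through a former rejecting state are stuck there, so they are no longer
   complete unless the whole tape has been read. *)
Definition drop_rejection : nfa Sigma :=
  Nfa (fun q a => if q \in nfa_rej M then finset.set0 else nfa_delta q a)
    (nfa_init M) disjoint_acc_set0.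

Lemma num_rej_drop_rejection x : num_rej_paths drop_rejection x = 0.
Proof. by apply: eq_card0 => p; rewrite !inE andbF. Qed.

(** A rejecting state yields no accepting path in [M], being halting and not accepting, and none in
    the new machine, having no successors. *)
Lemma num_acc_drop_rejection x :
  num_acc_paths drop_rejection x = num_acc_paths M x.
Proof.
rewrite /num_acc_paths !num_pathsE -[nfa_init _]/(nfa_init M) -[nfa_acc _]/(nfa_acc M).
move: (nfa_init M) (tape x) => q w; elim: w q => [|a w IH] q /=.
  by rewrite !if_same.
rewrite !inE orbF; case: (q \in nfa_acc M) => //=.
by case: (q \in nfa_rej M); [rewrite big_set0|apply: eq_bigr => q' _; apply: IH].
Qed.

End DropRejection.

Lemma oneN_sub_co_oneCeq L : oneN L -> oneCeq (co_family L).
Proof.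
case=> f [[M [[p Mp] fM]] fL].
exists (@PfunFamily (alphabet L) int (pf_dom f) (fun n x => (f n x)%:Z%R)); split.
  exists (fun n => drop_rejection (M n)); split; first by exists p.
  move=> n x fx /=.
  by rewrite num_rej_drop_rejection num_acc_drop_rejection subr0 fM.
move=> n; have [dom pos zero] := fL n; split=> /=.
- by move=> x; rewrite /= => -[]Lx; apply: dom; [right|left].
- by move=> x /zero->.
- by move=> x /pos; case: (f n x).
Qed.

(** * Strictness: words with equally many letters of each kind *)

Section BalancedWords.

(** [None] scans the word and branches at each letter [b] into the halting state [Some b], so every
    occurrence of [b] ends exactly one path; the scanning path itself dies at [RightEnd]. *)
Definition balanced_step (q : option bool) (a : tape_symbol bool) :
    {set option bool} :=
  if q is Some _ then finset.set0 else
  match a with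
  | LeftEnd => [set None]%SET
  | RightEnd => finset.set0
  | Letter b => [set None; Some b]%SET
  end.

Lemma balanced_disj :
  [disjoint [set Some true]%SET & [set Some false]%SET : {set option bool}].
Proof. by rewrite -setI_eq0; apply/eqP/setP => -[[]|]; rewrite !inE. Qed.

Definition balanced_nfa : nfa bool :=
  Nfa balanced_step None balanced_disj.

Lemma balanced_count b x :
  num_paths [set Some b : balanced_nfa]%SET x = count_mem b x.
Proof.
rewrite num_pathsE /= !inE /= big_set1.
elim: x => [|c x IH] /=; rewrite !inE /=; first by rewrite big_set0.
rewrite big_setU1 ?inE //= big_set1 IH addnC; congr addn.
by rewrite count_paths_halt ?inE; case: b c {IH} => [] [].
Qed.

Definition balanced_yes (n : nat) : set (seq bool) :=
  [set x | count_mem true x = count_mem false x].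

Definition balanced_no (n : nat) : set (seq bool) := ~` balanced_yes n.

Lemma bool_alphabet_gt0 : 0 < #|{: bool}|.
Proof. by rewrite card_bool. Qed.

Lemma balanced_yes_no n : (balanced_yes n `&` balanced_no n = set0)%classic.
Proof. exact: setICr. Qed.

Definition balanced : promise_family :=
  PromiseFamily bool_alphabet_gt0 balanced_yes_no.

Lemma balanced_oneCeq : oneCeq balanced.
Proof.
pose g (n : nat) (x : seq bool) : int :=
  ((count_mem true x)%:Z - (count_mem false x)%:Z)%R.
exists (PfunFamily (fun=> setT) g); split.
  exists (fun=> balanced_nfa); split.
    by exists (polyC 3) => n; rewrite hornerC card_option card_bool.
  by move=> n x _; rewrite /num_acc_paths /num_rej_paths !balanced_count.
move=> n; split=> [//|x e|x ne] /=.
  by rewrite /g e subrr.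
move/eqP; rewrite subr_eq0 => /eqP[e]; exact: ne.
Qed.

Lemma balanced_not_oneN : ~ oneN (co_family balanced).
Proof.
case=> f [[M [_ fM]] /(_ 0)[dom pos zero]].
pose N := M 0; pose S i : {set N} :=
  [set s | 0 < reach (nfa_init N) (LeftEnd :: map (@Letter bool) (nseq i true)) s]%SET.
have accE i j : (0 < f 0 (nseq i true ++ nseq j false)) =
    [exists s in S i, 0 < count_paths (nfa_acc N) s
                            (rcons (map (@Letter bool) (nseq j false)) RightEnd)].
  rewrite fM; last first.
    apply: dom.
  by case: (pselect (balanced_yes 0 (nseq i true ++ nseq j false))); [right|left].
  by rewrite /num_acc_paths num_pathsE tape_cat count_paths_gt0_cat.
have countE i j :
    balanced_yes 0 (nseq i true ++ nseq j false) <-> i = j.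
  by rewrite /balanced_yes /= !count_cat !count_nseq /= !mul1n !mul0n addn0.
(* With one more prefix than there are sets of states, two prefixes share their set. *)
have /injectivePn[i [j ij Sij]] :
    ~~ injectiveb (fun i : 'I_(#|{: {set N}}|.+1) => S i).
  by apply/negP => /injectiveP /leq_card; rewrite card_ord ltnn.
(* Since [i] and [j] differ this word is accepted; replacing [S j] by [S i] then forces acceptance
   of a balanced word. *)
have : 0 < f 0 (nseq j true ++ nseq i false).
  by apply: pos => /countE /val_inj /eqP; rewrite eq_sym (negbTE ij).
by rewrite accE -Sij -accE zero //; apply/countE.
Qed.

End BalancedWords.

(** * A linear-size machine detecting unequal halves *)

Section UnequalHalves.
Variable n : nat.

(* [None] has not guessed a position yet, [Some None] accepts, and
   [Some (Some (b, k))] has guessed a letter [b] and skips [k] letters before the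
   one it compares with [b]. *)
Definition halves_state : finType := option (option (bool * 'I_n)).

(** A guess at position [i] starts with [k = n - 1] letters to skip, so the comparison falls on
    position [i + n]. *)
Definition halves_step (q : halves_state) (a : tape_symbol bool)
    (q' : halves_state) : bool :=
  match q, a, q' with
  | None, LeftEnd, None => true
  | None, Letter _, None => true
  | None, Letter b, Some (Some (c, k)) => (c == b) && (k.+1 == n)
  | Some (Some (b, k)), Letter _, Some (Some (b', k')) =>
      (b' == b) && (k == k'.+1 :> nat)
  | Some (Some (b, k)), Letter c, Some None => (k == 0 :> nat) && (c != b)
  | _, _, _ => false
  end.

Lemma halves_disj :
  [disjoint [set Some None]%SET & finset.set0 : {set halves_state}].
Proof. by rewrite -setI_eq0 finset.setI0. Qed.

Definition halves_nfa : nfa bool :=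
  Nfa (fun q a => [set q' | halves_step q a q']%SET) None halves_disj.

Local Notation cnt := (@count_paths bool halves_nfa (nfa_acc halves_nfa)).
Local Notation word x := (rcons (map (@Letter bool) x) RightEnd).

(** The default [b] makes a position beyond the word count as no mismatch, matching a path that dies
    at [RightEnd]. *)
Lemma halves_count_wait b (k : 'I_n) x :
  cnt (Some (Some (b, k))) (word x) = (nth b x k != b).
Proof.
elim: x k => [|c x IH] k /=; rewrite !inE /=.
  by rewrite nth_nil eqxx big1 // => q; rewrite inE.
have [k0|k0] := posnP k.
  rewrite k0 /=; have [cb|cb] := eqVneq c b.
    rewrite big1 // => -[[[b' k']|]|]; rewrite inE /= ?k0 ?cb ?eqxx ?andbF //.
  rewrite (big_pred1 (Some None)) => [|[[[b' k']|]|]]; rewrite ?inE /= ?k0 ?cb ?andbF //.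
  by rewrite count_paths_halt ?inE.
have kn : k.-1 < n by apply: leq_ltn_trans (leq_pred _) (ltn_ord k).
rewrite (big_pred1 (Some (Some (b, Ordinal kn)))).
  by rewrite IH /= -[in RHS](prednK k0).
case=> [[[b' k']|]|]; rewrite ?inE /= ?(gtn_eqF k0) //.
rewrite -[RHS]/(Some (Some (b', k')) == Some (Some (b, Ordinal kn)) :> halves_state).
rewrite -[RHS]/((b' == b) && (k' == k.-1 :> nat)).
by rewrite -{1}(prednK k0) eqSS [k.-1 == _]eq_sym.
Qed.

Lemma halves_count_start x :
  cnt None (word x) =
  \sum_(i < size x) (nth (nth true x i) x (i + n) != nth true x i).
Proof.
elim: x => [|c x IH] /=; rewrite !inE /=.
  by rewrite big_ord0 big1 // => q; rewrite inE.
rewrite (bigD1 None) ?inE //= IH big_ord_recl /= addnC; congr addn.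
(* For [n = 0] no guess exists as ['I_n] is empty, and each letter is compared with itself. *)
rewrite add0n; case: (posnP n) => [n0|n_gt0].
  rewrite [in RHS]n0 /= eqxx big1 // => -[[[b k]|]|]; rewrite ?inE //=.
  by have := ltn_ord k; rewrite {2}n0.
have kn : n.-1 < n by rewrite prednK.
rewrite (big_pred1 (Some (Some (c, Ordinal kn)))).
  by rewrite halves_count_wait /= -[in RHS](prednK n_gt0).
case=> [[[b' k']|]|]; rewrite ?inE //=.
rewrite andbT -[RHS]/((b' == c) && (k' == n.-1 :> nat)).
by rewrite -[in RHS]eqSS prednK.
Qed.

Lemma halves_num_acc x :
  num_acc_paths halves_nfa x =
  \sum_(i < size x) (nth (nth true x i) x (i + n) != nth true x i).
Proof.
rewrite /num_acc_paths num_pathsE /= !inE /=.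
rewrite (big_pred1 None) ?halves_count_start // => q.
by rewrite inE; case: q.
Qed.

Lemma halves_num_acc_gt0 x : size x = n + n ->
  (0 < num_acc_paths halves_nfa x) = (take n x != drop n x).
Proof.
move=> sx; rewrite halves_num_acc lt0n sum_nat_eq0; congr negb.
have st : size (take n x) = n by rewrite size_take sx; case: ltnP; lia.
have sd : size (drop n x) = n by rewrite size_drop sx addnK.
apply/forallP/eqP => [h|e i].
  apply: (@eq_from_nth _ true); rewrite st ?sd // => i ltin.
  have ix : i < size x by rewrite sx ltn_addr.
  have := h (Ordinal ix); rewrite /= eqb0 negbK => /eqP e.
  rewrite nth_take // nth_drop -e addnC; apply: set_nth_default.
  by rewrite sx ltn_add2l.
(* For [i >= n] position [i + n] lies outside the word, and the default value makes the two sides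
   agree. *)
rewrite /= eqb0 negbK; have [ltin|leni] := ltnP i n; last first.
  by rewrite nth_default // [leqLHS]sx leq_add2r.
have -> : nth true x i = nth true x (i + n).
  by rewrite -(nth_take true ltin) e nth_drop addnC.
by apply/eqP/set_nth_default; rewrite [ltnRHS]sx ltn_add2r.
Qed.

End UnequalHalves.

Definition unequal_yes (n : nat) : set (seq bool) :=
  [set x | size x = n + n /\ take n x <> drop n x].

Definition unequal_no (n : nat) : set (seq bool) :=
  [set x | size x = n + n /\ take n x = drop n x].

Lemma unequal_yes_no n : (unequal_yes n `&` unequal_no n = set0)%classic.
Proof. by apply/seteqP; split=> x //= [[_ ne] [_ /ne]]. Qed.

Definition unequal_halves : promise_family :=
  PromiseFamily bool_alphabet_gt0 unequal_yes_no.

Lemma unequal_halves_oneN : oneN unequal_halves.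
Proof.
exists (PfunFamily (fun=> setT) (fun n => @num_acc_paths bool (halves_nfa n))); split.
  exists halves_nfa; split=> //; exists (2%:P * 'X + 2%:P)%R => n.
  by rewrite !hornerE /= !card_option card_prod card_bool card_ord; lia.
move=> n; split=> // x [sx /eqP e] /=; first by rewrite halves_num_acc_gt0.
by apply/eqP; rewrite eqn0Ngt halves_num_acc_gt0 // negbK.
Qed.

(** * Rank and growth bounds, and unequal halves outside 1C_= *)

Lemma card_le_of_diag_factor (T S : finType) (a : T -> S -> rat)
    (b : S -> T -> rat) :
  (forall i j, (\sum_s a i s * b s j == 0)%R = (i != j)) -> #|T| <= #|S|.
Proof.
move=> ab.
pose A := (\matrix_(i < #|T|, s < #|S|) a (enum_val i) (enum_val s))%R.
pose B := (\matrix_(s < #|S|, j < #|T|) b (enum_val s) (enum_val j))%R.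
have ABE i j : ((A *m B) i j == 0)%R = (i != j).
  rewrite -(inj_eq enum_val_inj) -ab !mxE; congr (_ == _).
  rewrite [RHS](reindex _ (onW_bij _ (enum_val_bij S))).
  by apply: eq_bigr => s _; rewrite !mxE.
have ABd : is_diag_mx (A *m B) by apply/is_diag_mxP => i j ij; apply/eqP; rewrite ABE.
(* A diagonal matrix with nonzero diagonal has full rank [#|T|], while the rank of a product is at
   most the inner dimension [#|S|]. *)
have ABu : (A *m B)%R \in unitmx.
  rewrite unitmxE unitfE det_trig ?is_diag_mx_is_trig //.
  by apply/prodf_neq0 => i _; rewrite ABE eqxx.
by rewrite -(mxrank_unit ABu) mulmx_max_rank.
Qed.

Lemma leq_sqr_exp2 k : 4 <= k -> k ^ 2 <= 2 ^ k.
Proof.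
elim: k => // k IH; rewrite leq_eqVlt => /predU1P[<-//|k4].
by have := IH k4; rewrite [2 ^ k.+1]expnS -!mulnn; nia.
Qed.

Lemma exp2_gt_horner (p : {poly nat}) : exists n, p.[n]%R < 2 ^ n.
Proof.
(* At [2 ^ k] the claim reduces to [k * (size p + 1) <= k ^ 2 <= 2 ^ k]. The summand [C] ensures
   [C < 2 ^ k], [size p] the first inequality, and [4] the second. *)
pose C := \sum_(i < size p) (p`_i)%R; pose k := C + size p + 4.
exists (2 ^ k).
have ple : p.[(2 ^ k)%N]%R <= C * 2 ^ (k * size p).
  rewrite horner_coef /C big_distrl /=; apply: leq_sum => i _.
  by rewrite natrME natrXE -expnM leq_mul2l leq_exp2l // leq_mul2l ltnW ?orbT.
apply: leq_ltn_trans ple _.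
have Clt : C < 2 ^ k.
  by apply: ltn_trans (ltn_expl k (ltnSn 1)); rewrite /k; lia.
apply: (@leq_trans (2 ^ k * 2 ^ (k * size p))).
  by rewrite ltn_pmul2r ?expn_gt0.
rewrite -expnD leq_exp2l //.
apply: leq_trans (leq_sqr_exp2 _); last by rewrite leq_addl.
by rewrite -mulnn -mulnS leq_mul2l /k; lia.
Qed.

Lemma unequal_halves_not_oneCeq : ~ oneCeq unequal_halves.
Proof.
case=> f [[M [[p Mp] fM]] fL].
have [n] := exp2_gt_horner p; rewrite ltnNge => /negP; apply.
apply: leq_trans (Mp n); have [dom zero nonzero] := fL n.
rewrite -card_bool -(card_tuple n bool).
(* Factorisation at the middle of the tape: [a] counts ways to reach [s] on the first half, [b] is
   the gap from [s] on the second. *)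
pose cnt F s (v : n.-tuple bool) : int :=
  (@count_paths bool (M n) F s (rcons (map (@Letter bool) v) RightEnd))%:Z%R.
pose a (u : n.-tuple bool) s : int :=
  (reach (nfa_init (M n)) (LeftEnd :: map (@Letter bool) u) s)%:Z%R.
pose b s v : int := (cnt (nfa_acc (M n)) s v - cnt (nfa_rej (M n)) s v)%R.
apply: (@card_le_of_diag_factor _ _ (fun u s => (a u s)%:~R) (fun s v => (b s v)%:~R))%R.
move=> u v.
under eq_bigr do rewrite -intrM.
rewrite -raddf_sum intr_eq0.
have suv : size (u ++ v) = n + n by rewrite size_cat !size_tuple.
have take_uv : take n (u ++ v) = u by rewrite take_size_cat ?size_tuple.
have drop_uv : drop n (u ++ v) = v by rewrite drop_size_cat ?size_tuple.
(* The promise covers every word of length [2n], so each matrix entry is a genuine value of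
   [f n]. *)
have -> : (\sum_s a u s * b s v)%R = f n (u ++ v).
  rewrite fM; last first.
    by apply: dom; have [uv|/eqP uv] := eqVneq u v; [right|left];
       split=> //=; rewrite take_uv drop_uv ?uv // => /val_inj.
  rewrite /num_acc_paths /num_rej_paths !num_pathsE tape_cat !count_paths_cat.
  rewrite !(big_morph Posz PoszD (erefl _)) -sumrB; apply: eq_bigr => s _.
  by rewrite !PoszM -mulrBr.
have [uv|/eqP uv] := eqVneq u v; last first.
  by rewrite zero //; split=> //=; rewrite take_uv drop_uv => /val_inj.
by apply/negbTE/eqP/nonzero; split=> //=; rewrite take_uv drop_uv uv.
Qed.

Theorem theorem4p6 :
  (class_proper oneN (co oneCeq) /\ class_proper (co oneN) oneCeq)
  /\ ~ class_sub oneN oneCeq.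
Proof.
split; [split; split|].
- by move=> L /oneN_sub_co_oneCeq CL; exists (co_family L); rewrite ?co_familyK.
- by move=> sub; apply/balanced_not_oneN/sub; exists balanced => //; exact: balanced_oneCeq.
- by move=> L [L' NL' ->]; apply: oneN_sub_co_oneCeq.
- move=> /(_ _ balanced_oneCeq)[L NL e]; apply: balanced_not_oneN.
  by rewrite e co_familyK.
- by move=> /(_ _ unequal_halves_oneN); apply: unequal_halves_not_oneCeq.
Qed.
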